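(* Let $X$ be a regular topological space and $\kappa$ a regular cardinal with $\chi(p,X)<\kappa$ for each $p\in X$. Then the following are equivalent: (a) $w(X)\ge\kappa$. (b) There are a subspace $Y\subset X$ of size $\kappa$ and a neighbourhood assignment $f:Y\to\tau_Y$ such that $|D_G^f|<\kappa$ for each $G\in\tau_Y$. (c) There are a subspace $Y\subset X$ of size $\kappa$ and a neighbourhood assignment $f:Y\to\tau_Y$ such that, for each $G\in\tau_Y$, $D_G^f$ is the union of fewer than $\kappa$ many pseudo weakly separated subspaces. Here $\tau_Y$ denotes the subspace topology on $Y$.
   Context: Here $w$ denotes weight and $\chi(p,X)$ the character of the point $p$ in $X$; as usual, cardinal functions take only infinite values, and regular spaces are assumed $T_1$. A neighbourhood assignment $f:Y\to\tau_Y$ is a function with $y\in f(y)$ for each $y\in Y$ (here its values are open subsets of the space $Y$). For $G\subset Y$ put $D_G^f=\{y\in Y: y\in G\subset f(y)\}$. A space $Z$ is weakly separated if there is a neighbourhood assignment $g$ on $Z$ such that for all $y\ne z$ in $Z$, $y\notin g(z)$ or $z\notin g(y)$. A space $Z$ is pseudo weakly separated if it contains a weakly separated subspace $Z'$ with $|Z'|=|Z|$. *)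

(* Defs.v *)
From mathcomp Require Import all_boot.
From mathcomp Require Import boolp classical_sets functions cardinality wochoice.
From mathcomp Require Import topology.

Set Implicit Arguments.
Unset Strict Implicit.
Unset Printing Implicit Defensive.

Local Open Scope classical_set_scope.
Local Open Scope card_scope.

(** Cardinals are represented by types [K], through the cardinality of
    [[set: K]], and compared with the relation [#<=] between sets. *)

Definition card_lt (T U : Type) (A : set T) (B : set U) : Prop :=
  A #<= B /\ ~ (B #<= A).
Notation "A '#<' B" := (card_lt A B)
  (at level 79, format "A  '#<'  B") : card_scope.

(** [R] is a (reflexive) well-order of [K] whose type is an initial ordinal:
    every proper initial segment has cardinality less than [K]. *)
Definition initial_well_order (K : Type) (R : rel K) : Prop :=
  well_order R /\ forall a, [set x | R x a /\ x <> a] #< [set: K].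

Definition cofinal (K : Type) (R : rel K) (A : set K) : Prop :=
  forall x, exists2 y, A y & R x y.

(** Infinite and equal to its cofinality. *)
Definition regular_cardinal (K : Type) : Prop :=
  infinite_set [set: K] /\
  exists2 R : rel K, initial_well_order R &
    forall A : set K, cofinal R A -> A #= [set: K].

(** Cardinal functions take only infinite values: the weight of [X] is
    max(omega, min |B|), for [B] ranging over the bases of [X]. The maximum
    with omega and the minimum over bases are spelled out in the comparison
    with [K], and likewise for the character. *)
Definition weight_ge (X : topologicalType) (K : Type) : Prop :=
  forall B : set (set X), basis B ->
    [set: K] #<= B \/ [set: K] #<= [set: nat].

Definition local_basis (X : topologicalType) (p : X) (B : set (set X)) : Prop :=
  B `<=` open_nbhs p /\ filter_from B id --> p.

Definition character_lt (X : topologicalType) (p : X) (K : Type) : Prop :=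
  exists B : set (set X),
    [/\ local_basis p B, B #< [set: K] & [set: nat] #< [set: K]].

(** A subset [A : set X], coerced to a type, carries the subspace topology. *)

Definition neighbourhood_assignment (Y : topologicalType) (f : Y -> set Y) :
    Prop :=
  forall y, open (f y) /\ f y y.

Definition Dset (Y : topologicalType) (f : Y -> set Y) (G : set Y) : set Y :=
  [set y | G y /\ G `<=` f y].

Definition weakly_separated (Z : topologicalType) : Prop :=
  exists2 g : Z -> set Z, neighbourhood_assignment g &
    forall y z : Z, y <> z -> ~ g z y \/ ~ g y z.

Definition pseudo_weakly_separated (Z : topologicalType) : Prop :=
  exists2 Z' : set Z, weakly_separated Z' & Z' #= [set: Z].

(* Main.v *)
(** Call a set small if it has fewer than kappa elements.

    (b) => (c) is trivial. For (c) => (a), given a small base, the pigeonhole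
    principle yields kappa many points y whose assigned neighbourhoods f y
    contain the same basic set G around y, so D_G has size kappa. One of the
    pieces of D_G then has size kappa, and so does a weakly separated subspace
    of it; but the same pigeonhole argument shows that a weakly separated
    space with a small base is small.

    (a) => (b): if X has a weakly separated subspace of size kappa, then its
    witnessing assignment has all D_G of size at most 1. Otherwise left and
    right separated families in X are small. By recursion pick p_a and an open
    U_a around p_a: while D_a = {p_b : b < a} is not dense, let U_a miss D_a;
    once it is dense, choose p_a and U_a so that no member V of the fixed
    local bases at the points of D_a satisfies p_a in V and
    V included in cl U_a (possible by regularity, since the union of these
    local bases is small, hence not a base). As left separated families are
    small, D_a is eventually dense. If D_G had size kappa, then G, being
    covered by a small number of basic V_y inside G with y in G, would have
    some p_a in D_G, with a beyond the indices of all these y, in some V_y;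
    but the trace of V_y on the dense set Y is inside U_a, so V_y is inside
    cl U_a, a contradiction. *)

Require Import Defs.
From mathcomp Require Import all_boot.
From mathcomp Require Import boolp classical_sets functions cardinality.
From mathcomp Require Import topology.

Set Implicit Arguments.
Unset Strict Implicit.

Local Open Scope classical_set_scope.
Local Open Scope card_scope.

(** * Small sets and regular cardinals *)

(** By comparability of cardinals this agrees with [A #< [set: K]], but the negation alone passes
    directly to subsets and images. *)
Definition small (K T : Type) (A : set T) : Prop :=
  ~ ([set: K] #<= A).

Lemma card_leT_inj (T U : Type) (A : set U) :
  [set: T] #<= A -> exists2 f : T -> U, injective f & forall x, A (f x).
Proof.
move=> /card_leP[f].
exists (fun x => val (f (exist _ x (mem_set I)))) => [x y /val_inj fxy|x].
  by have [] := inj (in_setT _) (in_setT _) fxy.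
exact: set_valP.
Qed.

Lemma card_lt_small (K T : Type) (A : set T) : A #< [set: K] -> small K A.
Proof. by case. Qed.

Lemma small_card_le (K T U : Type) (A : set T) (B : set U) :
  A #<= B -> small K B -> small K A.
Proof. by move=> AB sB KA; apply: sB; exact: card_le_trans AB. Qed.

Lemma small_image (K T U : Type) (f : T -> U) (A : set T) :
  small K A -> small K (f @` A).
Proof. exact/small_card_le/card_image_le. Qed.

Lemma small_subset (K T : Type) (A B : set T) :
  A `<=` B -> small K B -> small K A.
Proof. by move=> AB; exact/small_card_le/subset_card_le. Qed.

Lemma small_inj (K T U : Type) (f : T -> U) (A : set T) (B : set U) :
    {in A &, injective f} -> (forall x, A x -> B (f x)) ->
  small K B -> small K A.
Proof.
move=> finj AB; apply: small_card_le.
have /card_eqPle[_ Af] := inj_card_eq finj.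
by apply: card_le_trans Af _; apply: subset_card_le => _ [x /AB ? <-].
Qed.

(** [lt] behaves like the order of a regular infinite cardinal [K]. *)
Record regular_lt (K : Type) (lt : K -> K -> Prop) : Prop := RegularLt {
  regular_lt_infinite : infinite_set [set: K];
  regular_lt_wf : well_founded lt;
  regular_lt_trans : forall x y z, lt x y -> lt y z -> lt x z;
  regular_lt_total : forall x y, [\/ x = y, lt x y | lt y x];
  regular_lt_seg : forall a, small K [set x | lt x a];
  regular_lt_bound : forall A : set K, small K A ->
    exists b, forall a, A a -> lt a b }.

Lemma regular_ltP (K : Type) :
  regular_cardinal K -> exists lt : K -> K -> Prop, regular_lt lt.
Proof.
move=> [Kinf [R [Rwo Rseg] Rcof]].
have Rmin (A : set K) : A !=set0 ->
    exists z, [/\ A z, forall x, A x -> R z x &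
      forall z', A z' -> (forall x, A x -> R z' x) -> z = z'].
  move=> [a Aa]; have [|z [[Az zmin] zuniq]] := Rwo (mem A).
    by exists a; exact: mem_set.
  exists z; split=> [|x Ax|z' Az' z'min].
  - exact: set_mem.
  - by apply: zmin; exact: mem_set.
  - by apply: zuniq; split=> [|x xA]; [exact: mem_set|apply/z'min/set_mem].
(* The order axioms come from least elements of sets of at most three points; antisymmetry is their
   uniqueness. *)
have Rxx x : R x x.
  by have [|z [-> /(_ x erefl)]] := Rmin [set x]; first by exists x.
have Rtot x y : R x y \/ R y x.
  have [|z [[]-> zmin _]] := Rmin [set x; y]; first by exists x; left.
  - by left; apply: zmin; right.
  - by right; apply: zmin; left.
have Ranti x y : R x y -> R y x -> x = y.
  move=> Rxy Ryx; have [|z [_ _ zuniq]] := Rmin [set x; y].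
    by exists x; left.
  have <- : z = x by apply: zuniq; [left|move=> _ [] ->].
  by apply: zuniq; [right|move=> _ [] ->].
have Rtrans x y z : R x y -> R y z -> R x z.
  move=> Rxy Ryz.
  have [|m [mA mmin _]] := Rmin [set t | [\/ t = x, t = y | t = z]].
    by exists x; constructor 1.
  have [mx my mz] : [/\ R m x, R m y & R m z].
    by split; apply: mmin; [constructor 1|constructor 2|constructor 3].
  case: mA => e; subst m => //.
  - by rewrite (Ranti _ _ Rxy mx).
  - by rewrite -(Ranti _ _ Ryz my).
exists (fun x y => R x y /\ x <> y); constructor.
- exact: Kinf.
- apply: contrapT => /existsNP[a Na].
  have [|z [Nz zmin _]] := Rmin [set x | ~ Acc (fun x y => R x y /\ x <> y) x].
    by exists a.
  apply: Nz; constructor=> y [Ryz yz]; apply: contrapT => Ny.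
  by apply: yz; apply: Ranti => //; exact: zmin.
- move=> x y z [Rxy xy] [Ryz yz]; split; first exact: Rtrans Ryz.
  by move=> xz; subst z; apply: xy; exact: Ranti.
- move=> x y; have [->|xy] := pselect (x = y); first by constructor 1.
  have [Rxy|Ryx] := Rtot x y; first by constructor 2.
  by constructor 3; split=> // yx; exact: xy.
- by move=> a; exact/card_lt_small/Rseg.
(* Regularity: a small set is not cofinal, and a point witnessing this is a strict bound. *)
- move=> A sA; have : ~ cofinal R A.
    by move=> /Rcof; rewrite card_eq_le => /andP[_]; exact: sA.
  move=> /existsNP[b bA]; exists b => a Aa.
  have Nba : ~ R b a by move=> Rba; apply: bA; exists a.
  by split; [case: (Rtot a b)|move=> ab; subst b].
Qed.

Lemma regular_ltxx (K : Type) (lt : K -> K -> Prop) :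
  regular_lt lt -> forall x, ~ lt x x.
Proof.
move=> rK x; elim/(well_founded_ind (regular_lt_wf rK)): x => x IH xx.
exact: (IH x xx xx).
Qed.

Lemma finite_small (K T : Type) (A : set T) :
  infinite_set [set: K] -> finite_set A -> small K A.
Proof. by move=> Kinf Afin KA; apply: Kinf; exact: card_le_finite Afin. Qed.

Lemma small_bigcup (K : Type) (lt : K -> K -> Prop) (I T : Type) (F : set I)
    (A : I -> set T) : regular_lt lt ->
    small K F -> (forall i, F i -> small K (A i)) ->
  small K (\bigcup_(i in F) A i).
Proof.
move=> rK sF sA /card_leT_inj[f finj fA].
have [h hP] : {h : K -> I & forall k, F (h k) /\ A (h k) (f k)}.
  apply: (@choice _ _ (fun k i => F i /\ A i (f k))) => k.
  by have [i Fi Ai] := fA k; exists i.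
(* Each fibre of [h] is bounded, by [b i]; if [m] bounds the small set of all
   [b i], then [m < b (h m) < m]. *)
have [b bP] : {b : I -> K & forall i k, h k = i -> lt k (b i)}.
  apply: (@choice _ _ (fun i b => forall k, h k = i -> lt k b)) => i.
  suff /(regular_lt_bound rK)[b bP] : small K [set k | h k = i] by exists b.
  have [Fi|NFi] := pselect (F i).
    apply: (@small_inj _ _ _ f _ (A i)); last exact: sA.
    - by move=> x y _ _; exact: finj.
    - by move=> k <-; exact: (hP k).2.
  apply: finite_small (regular_lt_infinite rK) _.
  rewrite (_ : [set _ | _] = set0) //.
  by rewrite -subset0 => k /= hk; apply: NFi; rewrite -hk; exact: (hP k).1.
have [m mP] := regular_lt_bound rK (small_image (f := b) sF).
apply: (regular_ltxx rK (x := m)); apply: (regular_lt_trans rK (y := b (h m))).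
  exact: bP.
by apply: mP; exists (h m) => //; exact: (hP m).1.
Qed.

(** At each stage the earlier values form the image of a proper initial segment, a small set, so [P]
    can be met. *)
Lemma small_recursion (K : Type) (lt : K -> K -> Prop) (T : Type)
    (P : set T -> T -> Prop) : regular_lt lt ->
    (forall A, small K A -> exists t, P A t) ->
  exists s : K -> T, forall a, P (s @` [set b | lt b a]) (s a).
Proof.
move=> rK Pex.
have [g gP] : {g : set T -> T & forall A, small K A -> P A (g A)}.
  (* [t0] is the default value of [g] on sets that are not small. *)
  have [|t0 _] := cid (Pex set0 _).
    exact: finite_small (regular_lt_infinite rK) (finite_set0 _).
  apply: (@choice _ _ (fun A t => small K A -> P A t)) => A.
  have [/Pex[t Pt]|NsA] := pselect (small K A); first by exists t.
  by exists t0.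
pose F a (rec : forall b, lt b a -> T) :=
  g [set t | exists b (ba : lt b a), t = rec b ba].
pose s := Fix (regular_lt_wf rK) (fun=> T) F.
exists s => a.
have -> : s a = g (s @` [set b | lt b a]).
  rewrite /s Fix_eq -/s.
    congr g; apply/seteqP; split=> [_ [b [ba ->]]|_ [b ba <-]].
      by exists b.
    by exists b, ba.
  move=> x r r' rr'; congr g; apply/seteqP.
  by split=> _ [b [ba ->]]; exists b, ba; rewrite rr'.
by apply: gP; exact/small_image/(regular_lt_seg rK).
Qed.

(** * Pigeonhole in spaces of small weight *)

Definition small_weight (K : Type) (T : topologicalType) : Prop :=
  exists2 B : set (set T), basis B & small K B.

Lemma small_weight_subspace (K : Type) (T : topologicalType) (A : set T) :
  small_weight K T -> small_weight K A.
Proof.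
move=> [B [Bop Bbase] sB].
exists ((fun V => set_val @^-1` V) @` B : set (set A)).
  split=> [_ [V /Bop Vop <-]|x W]; first by exists V.
  rewrite nbhsE => -[_ [[O Oop <-] Ox] OW].
  have [|V [BV Vx] VO] := Bbase (set_val x) O.
    exact: open_nbhs_nbhs.
  exists (set_val @^-1` V); first by split=> //; exists V.
  by move=> y /VO; exact: OW.
exact: small_image.
Qed.

(** Every [y] lies in [Dset f V] for some basic [V] with [y] in [V] and [V] inside [f y], so these
    sets, over a small base, cover [Y]. *)
Lemma small_weight_Dset (K : Type) (lt : K -> K -> Prop) (Y : topologicalType)
    (f : Y -> set Y) : regular_lt lt -> small_weight K Y ->
    [set: K] #<= [set: Y] -> neighbourhood_assignment f ->
  exists2 G, open G & [set: K] #<= Dset f G.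
Proof.
move=> rK [B [Bop Bbase] sB] KY fnbhs.
apply: contrapT => noG; apply: (@small_bigcup K lt _ _ B (Dset f)) => //.
  by move=> G /Bop Gop KG; apply: noG; exists G.
apply: card_le_trans KY _; apply: subset_card_le => y _.
have [|V [BV Vy] Vf] := Bbase y (f y).
  exact: (open_nbhs_nbhs (fnbhs y)).
by exists V.
Qed.

Lemma weakly_separated_small (K : Type) (lt : K -> K -> Prop)
    (Z : topologicalType) : regular_lt lt -> small_weight K Z ->
  weakly_separated Z -> small K [set: Z].
Proof.
move=> rK sZ [g gnbhs gws] KZ.
have [G _] := small_weight_Dset rK sZ KZ gnbhs.
apply: finite_small (regular_lt_infinite rK) _.
(* Two points of [Dset g G] lie in each other's neighbourhoods, so there is at most one. *)
have [->|/set0P[z Gz]] := eqVneq (Dset g G) set0; first exact: finite_set0.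
apply: sub_finite_set (finite_set1 z) => y Gy; apply: contrapT => yz.
by case: (gws _ _ yz); apply; [exact: Gz.2 Gy.1|exact: Gy.2 Gz.1].
Qed.

(** * From large weight to small sets [Dset f G] *)

Definition has_small_Dsets (X : topologicalType) (K : Type) : Prop :=
  exists Y : set X, Y #= [set: K] /\
    exists2 f : Y -> set Y, neighbourhood_assignment f &
      forall G : set Y, open G -> Dset f G #< [set: K].

Lemma has_small_Dsets_family (X : topologicalType) (K : Type) (p : K -> X)
    (U : K -> set X) : injective p -> (forall a, open_nbhs (p a) (U a)) ->
    (forall G, open G ->
       small K [set a | G (p a) /\ G `&` range p `<=` U a]) ->
  has_small_Dsets X K.
Proof.
move=> pinj Unbhs sU.
have Ycard : range p #= [set: K] by apply: inj_card_eq => x y _ _; exact: pinj.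
exists (range p); split=> //.
have [q qP] : {q : range p -> K & forall y, p (q y) = val y}.
  apply: (@choice _ _ (fun y a => p a = val y)) => y.
  by have [a _ ay] := set_valP y; exists a.
exists (fun y => set_val @^-1` U (q y)) => [y|G [V Vop <-]].
  split; first by exists (U (q y)) => //; exact: (Unbhs _).1.
  by rewrite /preimage/= set_valE -qP; exact: (Unbhs _).2.
split.
  by rewrite -(card_le_eqr Ycard) -(card_le_eqr (card_setT _)) card_leT.
apply: (small_inj (f := q)) (sU V Vop) => [y z _ _ yz|y [Vy VU]].
  by apply: val_inj; rewrite -(qP y) -(qP z) yz.
split; first by rewrite qP.
move=> x [Vx Yx].
exact: (VU (exist _ x (mem_set Yx))).
Qed.

(** A weakly separated subspace of [X] of size [K], as an indexed family; the
    second clause makes [p] injective. *)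
Definition separated_family (X : topologicalType) (K : Type) : Prop :=
  exists (p : K -> X) (U : K -> set X),
    (forall a, open_nbhs (p a) (U a)) /\
    (forall a b, a <> b -> ~ U a (p b) \/ ~ U b (p a)).

Lemma has_small_Dsets_separated (X : topologicalType) (K : Type) :
  infinite_set [set: K] -> separated_family X K -> has_small_Dsets X K.
Proof.
move=> Kinf [p [U [Unbhs Usep]]].
apply: (has_small_Dsets_family (p := p) (U := U)) => // [a b pab|G _].
  apply: contrapT => /Usep; rewrite -pab {2}pab.
  by case; apply; exact: (Unbhs _).2.
apply: finite_small => //.
set S := [set a | _].
have [->|/set0P[a Sa]] := eqVneq S set0; first exact: finite_set0.
apply: sub_finite_set (finite_set1 a) => b Sb; apply: contrapT => /Usep.
case; apply.
  by apply: Sb.2; split; [exact: Sa.1|exists a].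
by apply: Sa.2; split; [exact: Sb.1|exists b].
Qed.

(** Otherwise one can keep choosing points of [S] outside the neighbourhoods of all earlier ones,
    which gives a right separated family of size [K]. *)
Lemma small_subcover (X : topologicalType) (K : Type) (lt : K -> K -> Prop)
    (S : set X) (V : X -> set X) : regular_lt lt -> ~ separated_family X K ->
    (forall y, S y -> open_nbhs y (V y)) ->
  exists A, [/\ A `<=` S, small K A & S `<=` \bigcup_(y in A) V y].
Proof.
move=> rK Nsep Vnbhs; apply: contrapT => NA; apply: Nsep.
have [|p pP] := small_recursion
    (P := fun A t => S t /\ forall y, A y -> S y -> ~ V y t) rK.
  move=> A sA; apply: contrapT => /forallNP Nt; apply: NA.
  exists (A `&` S); split=> [y []//||t St].
    exact: small_subset sA.
  apply: contrapT => Vt; apply: (Nt t); split=> // y Ay Sy Vyt; apply: Vt.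
  by exists y.
have pV a b : lt a b -> ~ V (p a) (p b).
  by move=> ab; apply: (pP b).2; [exists a|exact: (pP a).1].
exists p, (fun a => V (p a)); split=> [a|a b ab].
  exact/Vnbhs/(pP a).1.
by case: (regular_lt_total rK a b) => // /pV; [left|right].
Qed.

Lemma has_small_Dsets_weight_ge (X : topologicalType) (K : Type)
    (lt : K -> K -> Prop) : regular_lt lt -> regular_space X ->
    (forall p : X, exists2 B : set (set X), local_basis p B & small K B) ->
  ~ small_weight K X -> has_small_Dsets X K.
Proof.
move=> rK regX chiX wX.
have [sep|Nsep] := pselect (separated_family X K).
  exact: has_small_Dsets_separated (regular_lt_infinite rK) sep.
have [L LP] : {L : X -> set (set X) & forall p,
    local_basis p (L p) /\ small K (L p)}.
  apply: (@choice _ _ (fun p B => local_basis p B /\ small K B)) => p.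
  by have [B] := chiX p; exists B.
have Lsub p W : nbhs p W -> exists2 V, L p V & V `<=` W.
  by move=> /(LP p).1.2[V]; exists V.
have Lnbhs p V : L p V -> open_nbhs p V by move=> /(LP p).1.1.
pose P (A : set (X * set X)) (t : X * set X) := let D := fst @` A in
  [/\ open_nbhs t.1 t.2, ~ dense D -> t.2 `&` D = set0 &
    dense D -> forall d V, D d -> L d V -> V t.1 -> ~ V `<=` closure t.2].
have [A sA|s sP] := small_recursion (P := P) rK.
  have [denseD|NdenseD] := pselect (dense (fst @` A)); last first.
    have [O [[x Ox] OD]] := denseNE NdenseD.
    by exists (x, O).
  (* A point [x] and a neighbourhood [W] where this family fails to be a base give the new pair: by
     regularity [O] is taken with closure inside [W]. *)
  have : ~ basis (\bigcup_(d in fst @` A) L d).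
    move=> Bbasis; apply: wX; exists (\bigcup_(d in fst @` A) L d) => //.
    apply: (small_bigcup rK) => [|d _]; last exact: (LP d).2.
    exact: small_image.
  move=> /not_andP[|/existsNP[x]].
    by case=> V [d _ /Lnbhs[]].
  move=> /existsNP[W /not_implyP[xW NW]].
  have [U xU UW] := regX x W xW.
  move: xU; rewrite nbhsE => -[O [Oop Ox] OU].
  exists (x, O); split=> // _ d V Dd LV Vx VO; apply: NW.
  exists V; first by split=> //; exists d.
  by apply: subset_trans VO _; apply: subset_trans UW; exact: closureS.
pose p a := (s a).1; pose U a := (s a).2; pose D a := p @` [set b | lt b a].
have DE a : fst @` (s @` [set b | lt b a]) = D a by rewrite image_comp.
have Unbhs a : open_nbhs (p a) (U a) by case: (sP a).
have UND a : ~ dense (D a) -> U a `&` D a = set0.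
  by case: (sP a); rewrite DE.
have UD a : dense (D a) -> forall d V, D a d -> L d V -> V (p a) ->
    ~ V `<=` closure (U a).
  by case: (sP a); rewrite DE.
(* If [p a = p b], then [U b] meets [D b], and it contains a member of the local basis at [p a]; the
   two cases of the construction exclude one each. *)
have ltp a b : lt a b -> p a <> p b.
  move=> ab pab; have Dpa : D b (p a) by exists a.
  have [/UD Db|/UND UD0] := pselect (dense (D b)).
    have [|V LV VU] := Lsub (p a) (U b).
      by rewrite pab; exact: open_nbhs_nbhs.
    apply: (Db _ _ Dpa LV).
      by rewrite -pab; exact: (Lnbhs _ _ LV).2.
    by apply: subset_trans VU _; exact: subset_closure.
  suff : set0 (p a) by [].
  by rewrite -UD0; split=> //; rewrite pab; exact: (Unbhs b).2.
(* If no [D a] were dense, every [U a] would miss all earlier points: a left separated family. *)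
have [a0 dense0] : exists a, dense (D a).
  apply: contrapT => /forallNP Ndense; apply: Nsep.
  exists p, U; split=> // a b ab.
  have UN c d : lt c d -> ~ U d (p c).
    move=> cd Udc; suff : set0 (p c) by [].
    by rewrite -(UND _ (Ndense d)); split=> //; exists c.
  by case: (regular_lt_total rK a b) => // /UN; [right|left].
have denseS a : lt a0 a -> dense (D a).
  move=> a0a O O0 Oop; have [x [Ox [b ba0 bx]]] := dense0 O O0 Oop.
  by exists x; split=> //; exists b => //; exact: regular_lt_trans ba0 a0a.
apply: (has_small_Dsets_family (p := p) (U := U)) => // [a b pab|G Gop].
  by case: (regular_lt_total rK a b) => // /ltp; rewrite pab.
set S := [set a | _] => KS.
pose Y := range p.
have [V VP] : {V : X -> set X & forall y, G y -> L y (V y) /\ V y `<=` G}.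
  apply: (@choice _ _ (fun y V => G y -> L y V /\ V `<=` G)) => y.
  have [Gy|NGy] := pselect (G y); last by exists set0.
  have [|V] := Lsub y G; first exact: open_nbhs_nbhs.
  by exists V.
have [A [AG sA GA]] : exists A, [/\ A `<=` G `&` Y, small K A &
    G `&` Y `<=` \bigcup_(y in A) V y].
  apply: (small_subcover rK Nsep) => y [Gy _]; exact/Lnbhs/(VP y Gy).1.
have sI : small K [set a | A (p a)].
  apply: (small_inj (f := p)) sA => // a b _ _ pab.
  by case: (regular_lt_total rK a b) => // /ltp; rewrite pab.
have [c cP] := regular_lt_bound rK sI.
(* As [S] is not small, it has an index not below [e], hence beyond [a0] and the indices of all
   points of [A]. *)
have [e eP] : exists e, forall a, [set c; a0] a -> lt a e.
  apply: (regular_lt_bound rK).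
  exact: finite_small (regular_lt_infinite rK) (finite_set2 c a0).
have [a Sa Nae] : exists2 a, S a & ~ lt a e.
  apply: contrapT => NS; move: KS.
  apply: small_subset (regular_lt_seg rK (a := e)).
  by move=> a Sa; apply: contrapT => Nae; apply: NS; exists a.
have lta b : lt b e -> lt b a.
  case: (regular_lt_total rK a e) => [->//|//|ea be].
  exact: (regular_lt_trans rK be ea).
have a0a : lt a0 a by apply/lta/eP; right.
have ca : lt c a by apply/lta/eP; left.
have [|y Ay Vya] := GA (p a); first by split; [exact: Sa.1|exists a].
have [Gy [b _ pb]] := AG y Ay.
apply: (UD a (denseS a a0a) y (V y)) Vya _ => //.
- exists b => //; apply: (regular_lt_trans rK) ca; apply: cP.
  by rewrite /= pb.
- exact: (VP y Gy).1.
(* [V y] lies in the closure of [U a]: near any of its points there is a point of the dense [D a0]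
   in [V y], hence in [G] and in [U a]. *)
move=> x Vyx W; rewrite nbhsE => -[O [Oop Ox] OW].
have [||z [[Oz Vz] [b' b'a0 b'z]]] := dense0 (O `&` V y).
- by exists x.
- by apply: openI => //; exact: (Lnbhs _ _ (VP y Gy).1).1.
exists z; split; last exact: OW.
by apply: Sa.2; split; [exact: (VP y Gy).2|exists b'].
Qed.

(** * The equivalence of the three conditions *)

Unset Implicit Arguments.

Theorem theorem2p15 (X : topologicalType) (K : Type)
    (regX : regular_space X) (T1X : accessible_space X)
    (regK : regular_cardinal K) (uncK : ~ countable [set: K])
    (chiX : forall p : X, character_lt p K) :
  let a := weight_ge X K in
  let b := exists Y : set X, Y #= [set: K] /\
    exists2 f : Y -> set Y, neighbourhood_assignment f &
      forall G : set Y, open G -> Dset f G #< [set: K] in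
  let c := exists Y : set X, Y #= [set: K] /\
    exists2 f : Y -> set Y, neighbourhood_assignment f &
      forall G : set Y, open G ->
        exists F : set (set Y),
          [/\ F #< [set: K],
              (forall Z : set Y, F Z -> pseudo_weakly_separated Z) &
              Dset f G = \bigcup_(Z in F) Z] in
  (a <-> b) /\ (b <-> c).
Proof.
move=> a b c; have [lt rK] := regular_ltP regK.
have ab : a -> b.
  move=> wX; apply: (has_small_Dsets_weight_ge rK regX) => [p|[B Bbasis sB]].
    by have [B [LB /card_lt_small sB _]] := chiX p; exists B.
  by have [/sB|] := wX B Bbasis.
have ca : c -> a.
  move=> [Y [YK [f fnbhs fF]]] B Bbasis.
  apply: contrapT => /not_orP[sB _].
  have sX : small_weight K X by exists B.
  have sY : small_weight K Y := small_weight_subspace _ sX.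
  have KY : [set: K] #<= [set: Y].
    by rewrite (card_le_eqr (card_setT Y)) (card_le_eqr YK).
  have [G Gop] := small_weight_Dset rK sY KY fnbhs.
  have [F [/card_lt_small sF Fsep ->]] := fF G Gop.
  (* Each piece has the size of a weakly separated subspace, which is small since weight passes to
     subspaces. *)
  apply: (small_bigcup rK sF) => Z FZ.
  have [Z' Z'sep Z'Z] := Fsep Z FZ.
  have := weakly_separated_small rK
    (small_weight_subspace _ (small_weight_subspace _ sY)) Z'sep.
  apply: small_card_le; rewrite (card_le_eqr (card_setT Z')).
  by rewrite (card_le_eqr Z'Z) (card_le_eqr (card_setT Z)).
have bc : b -> c.
  move=> [Y [YK [f fnbhs fD]]]; exists Y; split=> //; exists f => // G Gop.
  exists ((fun y => [set y]) @` Dset f G); split.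
  - have [DK sD] := fD G Gop; split; last exact: small_image.
    exact: card_le_trans (card_image_le _ _) DK.
  (* The pieces are singletons, which are weakly separated vacuously. *)
  - move=> _ [y _ <-]; exists setT; last exact: card_eqxx.
    exists (fun=> setT) => [z|z z' zz']; first by split=> //; exact: openT.
    case: zz'; apply: val_inj; apply: val_inj.
    by rewrite (set_valP (set_val z)) (set_valP (set_val z')).
  - apply/seteqP; split=> [y Dy|y [_ [z Dz <-] ->]//].
    by exists [set y] => //; exists y.
by split; split=> //; [move=> /bc|move=> /ca/ab].
Qed.
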